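(* Let $\mathcal{G}$ be a second-countable locally compact Hausdorff étale groupoid that is effective. If $A$ is a $C^*$-algebra and $\phi : C^*_r(\mathcal{G}) \to A$ is a $C^*$-homomorphism that is injective on $C_0(\mathcal{G}^{(0)})$, then $\phi$ is injective on all of $C^*_r(\mathcal{G})$.
   Context: A groupoid $\mathcal{G}$ (a small category in which every morphism is invertible) is identified with its set of morphisms; $\mathcal{G}^{(0)} = \{\gamma^{-1}\gamma \mid \gamma \in \mathcal{G}\}$ is its unit space, $r(\gamma) = \gamma\gamma^{-1}$, $s(\gamma) = \gamma^{-1}\gamma$, and $\alpha\beta$ is defined iff $s(\alpha) = r(\beta)$. For a unit $x$, $\mathcal{G}_x = s^{-1}(x)$. A topological groupoid is a groupoid with a locally compact topology such that $\mathcal{G}^{(0)}$ is Hausdorff and $r$, $s$, inversion and multiplication are continuous. It is étale if $r : \mathcal{G} \to \mathcal{G}$ is a local homeomorphism (each point has an open neighbourhood $U$ with $r(U)$ open in $\mathcal{G}$ and $r|_U : U \to r(U)$ a homeomorphism); then $\mathcal{G}^{(0)}$ is open in $\mathcal{G}$. $C_c(\mathcal{G})$ is a $^*$-algebra with $(f*g)(\gamma) = \sum_{\alpha\beta=\gamma} f(\alpha)g(\beta)$ and $f^*(\gamma) = \overline{f(\gamma^{-1})}$. $C^*_r(\mathcal{G})$ is its completion in the norm $\|f\|_r = \sup_{x\in\mathcal{G}^{(0)}} \|\pi_x(f)\|$, where $\pi_x$ is the representation on $\ell^2(\mathcal{G}_x)$ given by $\pi_x(f)\delta_\gamma = \sum_{\alpha\in\mathcal{G}_{r(\gamma)}}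 f(\alpha)\delta_{\alpha\gamma}$. Extending functions on the clopen set $\mathcal{G}^{(0)}$ by zero embeds $C_c(\mathcal{G}^{(0)})$ in $C_c(\mathcal{G})$, and this extends to an inclusion $C_0(\mathcal{G}^{(0)})\subseteq C^*_r(\mathcal{G})$. $\mathcal{G}$ is effective if the interior in $\mathcal{G}$ of $\operatorname{Iso}(\mathcal{G}) = \{\gamma\in\mathcal{G}\mid r(\gamma) = s(\gamma)\}$ equals $\mathcal{G}^{(0)}$. *)

(* Defs.v *)
From HB Require Import structures.
From mathcomp Require Import all_boot all_order all_algebra.
From mathcomp Require Export complex.
From mathcomp Require Import all_classical all_reals all_analysis.

Set Implicit Arguments.
Unset Strict Implicit.
Unset Printing Implicit Defensive.

Import Order.TTheory GRing.Theory Num.Theory.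
Import numFieldNormedType.Exports.

Local Open Scope classical_set_scope.
Local Open Scope ring_scope.

(* The complex field is R[i] for R : realType.  Its norm, and the norms of
   normed modules over it, take values in R[i] (on the nonnegative real axis);
   its topology is carried by the alias R[i]^o. *)

(** * Groupoids *)

(* A groupoid is identified with its set of morphisms.  gmul is a total
   function whose value at (a, b) is meaningful only when s(a) = r(b); no axiom
   and no definition below uses it elsewhere.  The unit space is not a separate
   type of objects: units are the elements a^-1 a. *)
HB.mixin Record isGroupoid G := {
  gmul : G -> G -> G;
  ginv : G -> G;
  ginvK : involutive ginv;
  gmulA : forall a b c,
    gmul (ginv a) a = gmul b (ginv b) -> gmul (ginv b) b = gmul c (ginv c) ->
    gmul (gmul a b) c = gmul a (gmul b c);
  gmul_srcM : forall a b, gmul (ginv a) a = gmul b (ginv b) ->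
    gmul (ginv (gmul a b)) (gmul a b) = gmul (ginv b) b;
  gmul_rngM : forall a b, gmul (ginv a) a = gmul b (ginv b) ->
    gmul (gmul a b) (ginv (gmul a b)) = gmul a (ginv a);
  gmul_rngl : forall a, gmul (gmul a (ginv a)) a = a;
  gmul_srcr : forall a, gmul a (gmul (ginv a) a) = a
}.

#[short(type="groupoidType")]
HB.structure Definition Groupoid := {G of isGroupoid G}.

Definition grng (G : groupoidType) (a : G) : G := gmul a (ginv a).
Definition gsrc (G : groupoidType) (a : G) : G := gmul (ginv a) a.

Definition composable (G : groupoidType) (a b : G) : Prop := gsrc a = grng b.

Definition unit_space (G : groupoidType) : set G :=
  [set x | exists a : G, x = gsrc a].
Arguments unit_space G : clear implicits.

Definition src_fiber (G : groupoidType) (x : G) : set G :=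
  [set a | gsrc a = x].

Definition isotropy (G : groupoidType) : set G :=
  [set a | grng a = gsrc a].
Arguments isotropy G : clear implicits.

(* Multiplication is continuous on the set of composable pairs, with the
   topology induced from G * G.  The topology subspace A makes the points
   outside A isolated, so it is Hausdorff iff A is for the induced topology.
   Local compactness is not part of the structure: it is a separate
   hypothesis wherever it is needed. *)
HB.mixin Record isTopologicalGroupoid G of Groupoid G & Topological G := {
  gmul_continuous :
    {within [set p : G * G | composable p.1 p.2],
      continuous (fun p : G * G => gmul p.1 p.2)};
  ginv_continuous : continuous (@ginv G);
  grng_continuous : continuous (@grng G);
  gsrc_continuous : continuous (@gsrc G);
  unit_hausdorff : hausdorff_space (subspace (unit_space G))
}.

#[short(type="topGroupoidType")]
HB.structure Definition TopologicalGroupoid :=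
  {G of Groupoid G & Topological G & isTopologicalGroupoid G}.

Definition local_homeomorphism (X Y : topologicalType) (f : X -> Y) : Prop :=
  forall x : X, exists U : set X,
    [/\ open U, U x, open (f @` U), {within U, continuous f} &
      exists2 h : Y -> X, {within f @` U, continuous h} &
        forall u, U u -> h (f u) = u].

Definition etale (G : topGroupoidType) : Prop :=
  local_homeomorphism (@grng G).

Definition effective (G : topGroupoidType) : Prop :=
  interior (isotropy G) = unit_space G.

(** * C*-algebras *)

(* C*-algebras over R[i], not assumed unital; the zero algebra is allowed. *)
HB.mixin Record CompleteNormedModule_isCStarAlgebra (R : realType) A
    of CompleteNormedModule R[i] A := {
  cmul : A -> A -> A;
  cstar : A -> A;
  cmulA : associative cmul;
  cmulDl : left_distributive cmul +%R;
  cmulDr : right_distributive cmul +%R;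
  cscalerAl : forall (k : R[i]) (a b : A), k *: cmul a b = cmul (k *: a) b;
  cscalerAr : forall (k : R[i]) (a b : A), k *: cmul a b = cmul a (k *: b);
  cstarK : involutive cstar;
  cstarD : {morph cstar : a b / a + b};
  cstarZ : forall (k : R[i]) (a : A), cstar (k *: a) = Num.conj k *: cstar a;
  cstarM : forall a b : A, cstar (cmul a b) = cmul (cstar b) (cstar a);
  cnormM : forall a b : A, `|cmul a b| <= `|a| * `|b|;
  cnorm_star : forall a : A, `|cmul (cstar a) a| = `|a| ^+ 2
}.

#[short(type="cstarAlgType")]
HB.structure Definition CStarAlgebra (R : realType) :=
  {A of CompleteNormedModule R[i] A & CompleteNormedModule_isCStarAlgebra R A}.

(* Continuity is not assumed: it is automatic. *)
Record star_homomorphism (R : realType) (A B : cstarAlgType R) (phi : A -> B)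
    : Prop := StarHomomorphism {
  star_hom_linear : linear phi;
  star_homM : {morph phi : a b / cmul a b};
  star_hom_star : {morph phi : a / cstar a}
}.

(** * The convolution algebra and the reduced norm *)

Section ConvolutionAlgebra.
Variables (R : realType) (G : topGroupoidType).
Implicit Types (f g xi : G -> R[i]) (x : G).

Definition Cc : set (G -> R[i]) :=
  [set f | continuous (f : G -> R[i]^o) /\
           compact (closure [set a | f a != 0])].

(* The sums over \in below are 0 when infinitely many terms are nonzero, which
   does not happen for f, g in Cc when G is etale and Hausdorff. *)
Definition conv f g : G -> R[i] := fun c =>
  \sum_(p \in [set p : G * G | composable p.1 p.2 /\ gmul p.1 p.2 = c])
    f p.1 * g p.2.

Definition involution f : G -> R[i] := fun a => Num.conj (f (ginv a)).

(* pi_x(f) delta_b = \sum_(a in G_(r(b))) f(a) delta_(ab), evaluated at c *)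
Definition regular_rep_delta f (b c : G) : R[i] :=
  \sum_(a \in src_fiber (grng b)) f a * (gmul a b == c)%:R.

(* pi_x(f) on a vector xi = \sum_b xi(b) delta_b of l^2(G_x) *)
Definition regular_rep x f xi : G -> R[i] := fun c =>
  \sum_(b \in src_fiber x) xi b * regular_rep_delta f b c.

Definition l2norm x xi : \bar R :=
  sqrte (\esum_(b in src_fiber x) ((complex.Re `|xi b|) ^+ 2)%:E).

(* l^2(G_x), as functions on G vanishing off G_x *)
Definition ell2 x : set (G -> R[i]) :=
  [set xi | (forall b, ~ src_fiber x b -> xi b = 0) /\ (l2norm x xi < +oo)%E].

Definition regular_rep_norm x f : \bar R :=
  ereal_sup [set l2norm x (regular_rep x f xi) |
             xi in [set xi | ell2 x xi /\ (l2norm x xi <= 1)%E]].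

(* The element 0 only matters when G is empty: the supremum of the empty
   family of norms is then 0 rather than -oo. *)
Definition reduced_norm f : \bar R :=
  ereal_sup ([set 0%E] `|`
             [set regular_rep_norm x f | x in unit_space G]).

(* C_c(G^(0)) and C_0(G^(0)), as functions on G vanishing off G^(0) *)
Definition Cc_unit : set (G -> R[i]) :=
  [set f | [/\ forall a, ~ unit_space G a -> f a = 0,
               {within unit_space G, continuous (f : G -> R[i]^o)} &
               compact (unit_space G `&` closure [set a | f a != 0])]].

Definition C0_unit : set (G -> R[i]) :=
  [set f | [/\ forall a, ~ unit_space G a -> f a = 0,
               {within unit_space G, continuous (f : G -> R[i]^o)} &
               forall e : R[i], 0 < e ->
                 compact [set x | unit_space G x /\ e <= `|f x|]]].

End ConvolutionAlgebra.

Arguments Cc R G : clear implicits.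
Arguments Cc_unit R G : clear implicits.
Arguments C0_unit R G : clear implicits.

(** * The reduced C*-algebra *)

Section ReducedCStarAlgebra.
Variables (R : realType) (G : topGroupoidType) (B : cstarAlgType R).
Variable iota : (G -> R[i]) -> B.

(* B, together with iota, is the completion of the *-algebra Cc R G for the
   reduced norm.  The values of iota outside Cc R G are irrelevant. *)
Record is_reduced_cstar : Prop := IsReducedCStar {
  iota_linear : forall (k : R[i]) (f g : G -> R[i]), Cc R G f -> Cc R G g ->
    iota (fun a => k * f a + g a) = k *: iota f + iota g;
  iota_conv : forall f g : G -> R[i], Cc R G f -> Cc R G g ->
    iota (conv f g) = cmul (iota f) (iota g);
  iota_involution : forall f : G -> R[i], Cc R G f ->
    iota (involution f) = cstar (iota f);
  iota_norm : forall f : G -> R[i], Cc R G f ->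
    (complex.Re `|iota f|)%:E = reduced_norm f;
  iota_dense : dense [set iota f | f in Cc R G]
}.

(* The extension by continuity to C_0(G^(0)), for the sup norm, of the
   inclusion of C_c(G^(0)): f is sent to b iff (f, b) is a limit of pairs
   (g, iota g) with g in C_c(G^(0)). *)
Definition C0_inclusion (f : G -> R[i]) (b : B) : Prop :=
  forall e : R[i], 0 < e -> exists g : G -> R[i],
    [/\ Cc_unit R G g, forall x, unit_space G x -> `|f x - g x| <= e &
        `|b - iota g| <= e].

(* C_0(G^(0)) as a subset of the reduced C*-algebra *)
Definition C0_subalgebra : set B :=
  [set b | exists2 f, C0_unit R G f & C0_inclusion f b].

End ReducedCStarAlgebra.

(* Main.v *)
Require Import Defs.
From mathcomp Require Import finmap all_boot all_order all_algebra.
From mathcomp Require Import all_classical all_reals all_analysis.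
From mathcomp Require Import ring lra.

(** Let [a] be in the kernel of [phi], and let [g] be a function in [Cc] such
    that [iota g] is close to [a].  Write [f] for the product of [g] and its
    adjoint; it approximates [cmul a (cstar a)], which is again in the kernel.  The value
    of [f] at a unit [y] is the square sum of [g] over the elements with range
    [y].

    The main step ([fiber_sum_le_kernel_dist]) shows that these values are
    small.  If they exceed [lam], larger than the error of the approximation, then
    they do so on an open set of units.  Effectiveness gives a smaller open set
    [V] of units such that [f] vanishes at all elements that start and end in [V]
    without being units ([effective_shrink]).  Two functions [l] and [h]
    supported in [V] can be chosen such that [l f h = lam l], with [h] bounded
    by one and [l] nonzero ([cutoff_pair]).  In the quotient by the kernel,
    [lam^-1 f h] is the class of an element [z] of norm less than one, so that
    [l (1 - z) = 0] there; as [1 - z] is invertible by the Neumann series, [l]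
    is in the kernel ([ideal_absorb]).  This contradicts injectivity on the
    functions on the units.

    It remains to see that [a = 0].  The square sum of [g] over the elements
    with range [y] is that of the entries of a row of the matrix of [g] in a
    regular representation.  Hence, by the Cauchy-Schwarz inequality, as [iota g]
    tends to [a] all coordinates of the vectors [pi_x(g) xi] with [xi] in the
    unit ball tend to zero uniformly.  Since the [iota g] also form a Cauchy
    family for the reduced norm, their norms tend to zero
    ([reduced_norm_le_approx]). *)

Set Implicit Arguments.
Unset Strict Implicit.
Unset Printing Implicit Defensive.

Import Order.TTheory GRing.Theory Num.Theory.
Import numFieldNormedType.Exports.

Local Open Scope classical_set_scope.
Local Open Scope ring_scope.

(** * Groupoid algebra *)

Section GroupoidTheory.
Context {G : groupoidType}.
Implicit Types a b c x : G.

Lemma gsrcV a : gsrc (ginv a) = grng a.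
Proof. by rewrite /gsrc /grng ginvK. Qed.

Lemma grngV a : grng (ginv a) = gsrc a.
Proof. by rewrite /gsrc /grng ginvK. Qed.

Lemma gmul_rng a : gmul (grng a) a = a.
Proof. exact: gmul_rngl. Qed.

Lemma gmul_src a : gmul a (gsrc a) = a.
Proof. exact: gmul_srcr. Qed.

Lemma gsrcM a b : composable a b -> gsrc (gmul a b) = gsrc b.
Proof. exact: gmul_srcM. Qed.

Lemma grngM a b : composable a b -> grng (gmul a b) = grng a.
Proof. exact: gmul_rngM. Qed.

Lemma composableV a : composable a (ginv a).
Proof. by rewrite /composable grngV. Qed.

Lemma composableVl a : composable (ginv a) a.
Proof. by rewrite /composable gsrcV. Qed.

Lemma gsrc_src a : gsrc (gsrc a) = gsrc a.
Proof. exact: gsrcM (composableVl a). Qed.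

Lemma grng_src a : grng (gsrc a) = gsrc a.
Proof. by rewrite -[RHS]grngV; exact: grngM (composableVl a). Qed.

Lemma gsrc_rng a : gsrc (grng a) = grng a.
Proof. by rewrite -(gsrcV a) gsrc_src. Qed.

Lemma grng_rng a : grng (grng a) = grng a.
Proof. by rewrite -(gsrcV a) grng_src. Qed.

Lemma unit_src a : unit_space G (gsrc a).
Proof. by exists a. Qed.

Lemma unit_rng a : unit_space G (grng a).
Proof. by rewrite -gsrcV; exact: unit_src. Qed.

Lemma unit_gsrc x : unit_space G x -> gsrc x = x.
Proof. by move=> [a ->]; rewrite gsrc_src. Qed.

Lemma unit_grng x : unit_space G x -> grng x = x.
Proof. by move=> [a ->]; rewrite grng_src. Qed.

Lemma unit_ginv x : unit_space G x -> ginv x = x.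
Proof.
move=> ux; rewrite -{1}(gmul_src (ginv x)) gsrcV unit_grng//.
exact: unit_gsrc.
Qed.

Lemma unit_gmul x : unit_space G x -> gmul x x = x.
Proof. by move=> ux; rewrite -{2}(unit_gsrc ux) gmul_src. Qed.

Lemma gmulKV a b : composable a b -> gmul (ginv a) (gmul a b) = b.
Proof.
move=> ab; have ab' : gsrc a = grng b := ab.
rewrite -gmulA//; last exact: composableVl.
by rewrite -/(gsrc a) ab' gmul_rng.
Qed.

Lemma gmulVK a b : composable a b -> gmul (gmul a b) (ginv b) = a.
Proof.
move=> ab; have ab' : gsrc a = grng b := ab.
rewrite gmulA//; last exact: composableV.
by rewrite -/(grng b) -ab' gmul_src.
Qed.

Lemma gmul_divK b c : gsrc b = gsrc c -> gmul (gmul c (ginv b)) b = c.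
Proof.
move=> bc; have cb : composable c (ginv b) by rewrite /composable grngV.
by have := gmulVK cb; rewrite ginvK.
Qed.

Lemma gmul_ldivK a c : grng a = grng c -> gmul a (gmul (ginv a) c) = c.
Proof.
move=> ac; have ac' : composable (ginv a) c by rewrite /composable gsrcV.
by have := gmulKV ac'; rewrite ginvK.
Qed.

Lemma gmul_ldivV a c : grng a = grng c -> gmul c (ginv (gmul (ginv a) c)) = a.
Proof.
move=> ac; rewrite -{1}(gmul_ldivK ac) gmulVK//.
by rewrite /composable grngM ?grngV// /composable gsrcV.
Qed.

Lemma gmul_divV b c : gsrc b = gsrc c -> gmul (ginv (gmul c (ginv b))) c = b.
Proof.
move=> bc; rewrite -{2}(gmul_divK bc) gmulKV//.
by rewrite /composable gsrcM ?gsrcV// /composable grngV.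
Qed.

Lemma unit_gmulE a b : composable a b -> unit_space G (gmul a b) -> b = ginv a.
Proof.
move=> ab uab; rewrite -(gmulKV ab) -(unit_grng uab) grngM//.
by rewrite -gsrcV gmul_src.
Qed.

End GroupoidTheory.

(** * Compactness and separation *)

(** Local properties of subsets that are stable under finite unions pass to
    compact sets; this stands for the extraction of finite covers below.  If [C]
    did not have the property, the sets whose complement in [C] has it would form
    a proper filter, and locality fails at a cluster point of it. *)
Lemma compact_local_ind (T : topologicalType) (C : set T)
    (P : set T -> Prop) :
  compact C -> P set0 ->
  (forall A B, P A -> P B -> P (A `|` B)) ->
  (forall A B, A `<=` B -> P B -> P A) ->
  (forall x, C x -> exists2 U, nbhs x U & P U) -> P C.
Proof.
move=> cC P0 PU PS Ploc; apply: contrapT => nPC.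
pose F : set_system T := [set A | P (C `\` A)].
have FF : ProperFilter F.
  apply: Build_ProperFilter_ex.
    move=> A FA; apply: contrapT => A0; apply: nPC.
    by apply: PS FA => x Cx; split => // Ax; apply: A0; exists x.
  split=> [|A B FA FB|A B AB FA].
  - by rewrite /F/= setDT.
  - by rewrite /F/= setDIr; exact: PU.
  - by apply: PS FA => x [Cx nBx]; split => // Ax; apply/nBx/AB.
have FC : F C by rewrite /F/= setDv.
have [p [Cp clp]] := cC F FF FC.
have [U Up PUp] := Ploc _ Cp.
have FU : F (~` U) by rewrite /F/= setDE setCK; apply: PS PUp => x [].
by have [q []] := clp _ _ FU Up.
Qed.

Lemma hausdorff_separate (T : topologicalType) (x y : T) :
  hausdorff_space T -> x <> y ->
  exists A B : set T, [/\ nbhs x A, nbhs y B & forall z, A z -> B z -> False].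
Proof.
move=> hT xy; apply: contrapT => sep; apply: xy; apply: hT => A B Ax By.
apply: contrapT => AB; apply: sep; exists A, B; split => // z Az Bz.
by apply: AB; exists z.
Qed.

Lemma hausdorff_closed_eq (T U : topologicalType) (f g : T -> U) :
  hausdorff_space U -> continuous f -> continuous g ->
  closed [set x | f x = g x].
Proof.
move=> hU cf cg; rewrite -openC openE => x /= fgx.
have [A [B [Ax Bx AB]]] := hausdorff_separate hU fgx.
have nA : nbhs x (f @^-1` A) by exact: cf.
have nB : nbhs x (g @^-1` B) by exact: cg.
apply: filterS (filterI nA nB) => z [/= Afz Bgz] fgz; apply: (AB (f z)) => //.
by rewrite fgz.
Qed.

Lemma near_all_seq (T : Type) (I : eqType) (F : set_system T) (s : seq I)
    (P : I -> T -> Prop) : Filter F ->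
  (forall i, i \in s -> \forall x \near F, P i x) ->
  \forall x \near F, forall i, i \in s -> P i x.
Proof.
move=> FF; elim: s => [|i s IH] Ps; first by apply: nearW.
have Pi := Ps i (mem_head _ _).
have {}IH : \forall x \near F, forall j, j \in s -> P j x.
  by apply: IH => j js; apply: Ps; rewrite inE js orbT.
apply: filterS (filterI Pi IH) => x [Pix Psx] j.
by rewrite inE => /predU1P[->//|]; exact: Psx.
Qed.

(** * Étale groupoids *)

Section EtaleTheory.
Context {G : topGroupoidType}.
Hypothesis G_etale : etale G.
Implicit Types (a c x : G) (U V W : set G).

(** The local inverse [h] of the range map, repackaged with the neighbourhoods
    of [grng a] on which it is a section of that map with values near [a]. *)
Lemma local_section a : exists (U : set G) (h : G -> G),
  [/\ open U, U a, (forall u, U u -> h (grng u) = u),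
      {for grng a, continuous h} &
      forall W, open W -> W a ->
        \forall y \near grng a, [/\ U (h y), W (h y) & grng (h y) = y]].
Proof.
have [U [oU Ua oV rc [h hc hK]]] := G_etale a.
have Vra : (@grng G @` U) (grng a) by exists a.
have hca : {for grng a, continuous h}.
  move: hc; rewrite (continuous_open_subspace _ oV) => /(_ (grng a)).
  by apply; rewrite inE.
exists U, h; split => // W oW Wa.
have nW : nbhs (h (grng a)) W by rewrite hK//; exact: open_nbhs_nbhs.
have nV : nbhs (grng a) (@grng G @` U) by exact: open_nbhs_nbhs.
apply: filterS (filterI nV (hca _ nW)) => _ [[u Uu <-] Wu].
by move: Wu => /=; rewrite hK.
Qed.

Lemma open_range W : open W -> open [set grng a | a in W].
Proof.
move=> oW; rewrite openE => _ [a Wa <-].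
have [U [h [_ _ _ _ /(_ W oW Wa)]]] := local_section a.
by apply: filterS => y [_ Wy ry]; exists (h y).
Qed.

Lemma open_source W : open W -> open [set gsrc a | a in W].
Proof.
move=> oW.
suff -> : [set gsrc a | a in W] = [set grng a | a in (@ginv G) @^-1` W].
  by apply: open_range; apply: open_comp => // x _; exact: ginv_continuous.
apply/seteqP; split=> _ [a Wa <-].
  by exists (ginv a); rewrite /= ?ginvK// grngV.
by exists (ginv a); rewrite // gsrcV.
Qed.

Lemma open_unit_space : open (unit_space G).
Proof.
suff -> : unit_space G = [set grng a | a in [set: G]].
  by apply: open_range; exact: openT.
apply/seteqP; split => [x ux|_ [a _ <-]]; last exact: unit_rng.
by exists x; rewrite ?unit_grng.
Qed.

Lemma local_source_inj a : exists U : set G,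
  [/\ open U, U a & forall u v, U u -> U v -> gsrc u = gsrc v -> u = v].
Proof.
have [U [h [oU Ua hK _ _]]] := local_section (ginv a).
exists ((@ginv G) @^-1` U); split => //.
  by apply: open_comp => // x _; exact: ginv_continuous.
move=> u v Uu Uv uv; apply: (can_inj (@ginvK G)).
by rewrite -(hK _ Uu) -(hK _ Uv) !grngV uv.
Qed.

(** A compact set is covered by finitely many sets on which the range map is
    injective, so it has finitely many elements with a given range. *)
Lemma finite_range_fiber (K : set G) x :
  compact K -> finite_set (K `&` [set c | grng c = x]).
Proof.
move=> cK; apply: (compact_local_ind
  (P := fun A => finite_set (A `&` [set c | grng c = x])) cK).
- by rewrite set0I; exact: finite_set0.
- by move=> A B fA fB; rewrite setIUl finite_setU.
- by move=> A B AB; apply: sub_finite_set; exact: setSI.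
move=> a _; have [U [h [oU Ua hK _ _]]] := local_section a.
exists U; first exact: open_nbhs_nbhs.
apply: (@sub_finite_set _ _ [set h x]); last exact: finite_set1.
by move=> c [Uc /= <-]; rewrite hK.
Qed.

Hypothesis G_hausdorff : hausdorff_space G.

Lemma closed_unit_space : closed (unit_space G).
Proof.
suff -> : unit_space G = [set x | grng x = id x].
  apply: hausdorff_closed_eq => //; first exact: grng_continuous.
  by move=> x; exact: cvg_id.
apply/seteqP; split => [x /unit_grng//|x /= <-]; exact: unit_rng.
Qed.

(** Over a neighbourhood of [x] the support of [n] is the disjoint union of the
    graphs of finitely many local sections, one for each of its points with
    range [x]; so the sum is locally a finite sum of continuous functions. *)
Lemma continuous_fiber_sum (R : realType) (K : set G) (n : G -> R) :
  compact K -> continuous n -> (forall c, ~ K c -> n c = 0) ->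
  continuous (fun y => \sum_(c \in [set c | grng c = y]) n c : R).
Proof.
move=> cK cn n0 x.
have /finite_fsetP[X0 SX] := finite_range_fiber x cK.
pose X : seq G := X0; have uX : uniq X by exact: fset_uniq.
have XP c : c \in X <-> K c /\ grng c = x.
  by have /(congr1 (fun A : set G => A c)) := SX => /= <-.
have /choice[U /choice[h hP]] := local_section.
have hx c : c \in X -> h c x = c.
  by move=> /XP[_ <-]; have [_ Uc hK _ _] := hP c; exact: hK.
have hcx c : c \in X -> {for x, continuous (h c)}.
  by move=> /XP[_ <-]; have [] := hP c.
have hsec : \forall y \near x, forall c, c \in X ->
    U c (h c y) /\ grng (h c y) = y.
  apply: near_all_seq => c /XP[_ <-]; have [oU Uc _ _ /(_ _ oU Uc)] := hP c.
  by apply: filterS => y [].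
have hinj : \forall y \near x, forall c, c \in X -> forall d, d \in X ->
    h c y = h d y -> c = d.
  apply: near_all_seq => c cX; apply: near_all_seq => d dX.
  have [->|/eqP cd] := eqVneq c d; first exact: nearW.
  have [A [B [Ac Bd AB]]] := hausdorff_separate G_hausdorff cd.
  have hA : nbhs x (h c @^-1` A) by apply: hcx => //; rewrite hx.
  have hB : nbhs x (h d @^-1` B) by apply: hcx => //; rewrite hx.
  apply: filterS (filterI hA hB) => y [/= Ay By] hcd.
  by case: (AB (h c y)) => //; rewrite hcd.
(* What the sections leave of [K] is compact, and [x] is not in its range. *)
have hcov : \forall y \near x, forall c, K c -> grng c = y ->
    exists2 d, d \in X & U d c.
  pose K' := K `&` ~` \bigcup_(d in [set` X]) U d.
  have oX : open (\bigcup_(d in [set` X]) U d).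
    by apply: bigcup_open => d _; have [] := hP d.
  have cK' : compact K' by apply: compact_closedI => //; exact: open_closedC.
  have crK' : closed [set grng c | c in K'].
    apply: compact_closed => //; apply: continuous_compact => //.
    by apply: continuous_subspaceT; exact: grng_continuous.
  have nx : (~` [set grng c | c in K']) x.
    move=> [c [Kc Xc] cx]; apply: Xc; exists c; first by apply/XP.
    by have [] := hP c.
  have : nbhs x (~` [set grng c | c in K']).
    by apply: open_nbhs_nbhs; split => //; exact: closed_openC.
  apply: filterS => y ny c Kc cy; apply: contrapT => nX; apply: ny.
  by exists c => //; split=> // -[d dX Udc]; apply: nX; exists d.
have sumE : \forall y \near x, \sum_(c \in [set c | grng c = y]) n c =
    \sum_(c <- X) n (h c y).
  near=> y.
  have sec : forall c, c \in X -> U c (h c y) /\ grng (h c y) = y by near: y.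
  have inj : forall c, c \in X -> forall d, d \in X -> h c y = h d y -> c = d.
    by near: y.
  have cov : forall c, K c -> grng c = y -> exists2 d, d \in X & U d c.
    by near: y.
  rewrite -(@fsbig_widen _ _ _ _ (h^~ y @` [set` X])); first last.
  - move=> c [/= cy nc]; apply: n0 => Kc; apply: nc.
    have [d dX Udc] := cov c Kc cy; exists d => //.
    by have [_ _ hK _ _] := hP d; rewrite -cy hK.
  - by move=> _ [c cX <-] /=; have [] := sec c cX.
  rewrite fsbig_image//; last first.
    by move=> c d; rewrite !inE => cX dX; exact: inj.
  by rewrite -fsbig_seq.
rewrite /continuous_at (nbhs_singleton sumE).
have cF0 : (\sum_(c <- X) n (h c y)) @[y --> x] --> \sum_(c <- X) n (h c x).
  rewrite [in X in _ --> X]big_seq.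
  under eq_fun do rewrite big_seq.
  apply: cvg_big => [|c cX]; first exact: add_continuous.
  by apply: continuous_comp; [exact: hcx|exact: cn].
apply: cvg_trans cF0; apply: near_eq_cvg.
by apply: filterS sumE => y; exact: esym.
Unshelve. all: by end_near. Qed.

End EtaleTheory.

(** * Effective groupoids *)

Section EffectiveTheory.
Context {G : topGroupoidType}.
Hypothesis G_hausdorff : hausdorff_space G.

Lemma compact_composable_products (K L : set G) : compact K -> compact L ->
  compact [set gmul p.1 p.2 | p in
             (K `*` L) `&` [set p : G * G | composable p.1 p.2]].
Proof.
move=> cK cL; apply: continuous_compact.
  by apply: continuous_subspaceW gmul_continuous => p [].
apply: compact_closedI; first exact: compact_setX.
have -> : [set p : G * G | composable p.1 p.2] =
    [set p | (@gsrc G \o fst) p = (@grng G \o snd) p] by [].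
apply: hausdorff_closed_eq => // p; apply: continuous_comp.
- exact: cvg_fst.
- exact: gsrc_continuous.
- exact: cvg_snd.
- exact: grng_continuous.
Qed.

Hypothesis G_etale : etale G.
Hypothesis G_effective : effective G.

(** Effectiveness in the form in which it is used.  Let [W] be an open set
    without units on which the source map is injective.  If some element of [W]
    starts and ends in [U], then by effectiveness some such element joins two
    distinct points, and as it is the only element of [W] with its source, a
    small neighbourhood of that source is moved off itself by [W].  Finitely many
    such [W] cover the part of [C] outside the units, and [U] can be shrunk for
    each of them in turn. *)
Lemma effective_shrink (C U : set G) :
  compact C -> open U -> U !=set0 -> U `<=` unit_space G ->
  exists V : set G, [/\ open V, V !=set0, V `<=` U &
    forall c, C c -> V (grng c) -> V (gsrc c) -> unit_space G c].
Proof.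
move=> cC; move: U; apply: (compact_local_ind (P := fun A => forall U,
  open U -> U !=set0 -> U `<=` unit_space G ->
  exists V : set G, [/\ open V, V !=set0, V `<=` U &
    forall c, A c -> V (grng c) -> V (gsrc c) -> unit_space G c]) cC).
- by move=> U oU U0 UG; exists U; split => // c [].
- move=> A B hA hB U oU U0 UG; have [V [oV V0 VU hV]] := hA U oU U0 UG.
  have [W [oW W0 WV hW]] := hB V oV V0 (subset_trans VU UG).
  exists W; split => //; first exact: subset_trans WV VU.
  by move=> c [Ac|Bc] rc sc; [apply: hV => //; exact: WV|exact: hW].
- move=> A B AB hB U oU U0 UG; have [V [oV V0 VU hV]] := hB U oU U0 UG.
  by exists V; split => // c /AB; exact: hV.
move=> a _; have [W0 [oW0 W0a injW0]] := local_source_inj G_etale a.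
exists W0; first exact: open_nbhs_nbhs.
move=> U oU U0 UG.
pose W := W0 `&` ~` unit_space G.
have oW : open W.
  by apply: openI => //; apply: closed_openC; exact: closed_unit_space.
pose D := W `&` (@grng G @^-1` U `&` @gsrc G @^-1` U).
have oD : open D.
  apply: openI => //; apply: openI; apply: open_comp => // x _.
    exact: grng_continuous.
  exact: gsrc_continuous.
have [D0|] := pselect (D !=set0); last first.
  move=> D0; exists U; split => // c W0c rc sc; apply: contrapT => nc.
  by apply: D0; exists c.
(* [D] is open without units, so it is not contained in the isotropy. *)
have [c Dc rsc] : exists2 c, D c & grng c <> gsrc c.
  apply: contrapT => nD; have [c Dc] := D0.
  have : (isotropy G)^° c.
    apply: (@filterS _ _ _ D); last exact: open_nbhs_nbhs.
    by move=> d Dd; apply: contrapT => rsd; apply: nD; exists d.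
  by rewrite G_effective; have [[_ +] _] := Dc.
have [A [B [Ar Bs AB]]] := hausdorff_separate G_hausdorff rsc.
pose E := D `&` (@grng G @^-1` A^° `&` @gsrc G @^-1` B^°).
have oE : open E.
  apply: openI => //; apply: openI; apply: open_comp;
    try exact: open_interior; move=> x _.
    exact: grng_continuous.
  exact: gsrc_continuous.
exists [set gsrc d | d in E]; split.
- exact: open_source.
- exists (gsrc c), c => //; split => //.
- by move=> _ [d [[_ [_ sd]] _] <-].
move=> d W0d [d1 [_ [_ Bd1]] d1E] [d2 [[[W0d2 _] _] [Ad2 _]] d2E].
exfalso; apply: (AB (grng d)).
  by rewrite -(injW0 _ _ W0d2 W0d d2E); exact: interior_subset.
by rewrite -d1E; exact: interior_subset.
Qed.

End EffectiveTheory.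

(** * Bump functions *)

Lemma locally_compact_bump (R : realType) (T : topologicalType)
    (V : set T) (x : T) :
  locally_compact [set: T] -> hausdorff_space T -> open V -> V x ->
  exists p : T -> R, [/\ continuous p, (forall y, 0 <= p y <= 1), p x = 1 &
    exists2 K, compact K & K `<=` V /\ forall y, ~ K y -> p y = 0].
Proof.
move=> lcT hT oV Vx.
have crT := locally_compact_completely_regular (R := R) lcT hT.
have [C nC cC] : exists2 C, nbhs x C & compact C.
  have [C nC [cC _]] := lcT x I; exists C => //.
  have {}nC : nbhs x [set y | [set: T] y -> C y] := nC.
  by apply: filterS nC => y; exact.
have [N nN NV] : filter_from (nbhs x) closure V.
  by apply: (completely_regular_regular (R := R) crT); exact: open_nbhs_nbhs.
pose K := closure N `&` C.
have cK : compact K.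
  by rewrite /K setIC; apply: compact_closedI => //; exact: closed_closure.
have nK : K^° x.
  by apply: filterI => //; apply: filterS nN; exact: subset_closure.
have /uniform_separatorP : uniform_separator [set x] (~` K^°).
  by apply: crT; [exact: open_closedC (open_interior _)|move=> /(_ nK)].
move=> /(_ R)[f [cf f01 fx fK]].
exists (fun y => 1 - f y); split.
- by move=> y; apply: cvgB; [exact: cvg_cst|exact: cf].
- move=> y; have /f01 := imageP f (I : setT y).
  by rewrite /= in_itv/= => /andP[f0 f1]; rewrite subr_ge0 f1 lerBlDr lerDl.
- by have := fx (f x) (imageP f (erefl x : [set x] x)) => /= ->; rewrite subr0.
exists K => //; split=> [|y nKy].
  by move=> y [Ny _]; exact: NV.
have /= -> := fK (f y) _; first by rewrite subrr.
by exists y => //; apply: contra_not nKy; exact: interior_subset.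
Qed.

(** * Real-valued norms over the complex numbers *)

(** Norms over [R[i]] are valued in [R[i]]; taking the real part gives access to
    real arithmetic and to real-valued continuity. *)
Definition rnorm (R : realType) (V : normedZmodType R[i]) (v : V) : R :=
  complex.Re `|v|.

Local Notation "x %:C" := (real_complex _ x) (format "x %:C") : ring_scope.

Section RealNorm.
Context {R : realType}.

Section NormedZmod.
Context {V : normedZmodType R[i]}.
Implicit Types v w : V.

Lemma rnormE v : `|v| = (rnorm v)%:C.
Proof. by rewrite /rnorm RRe_real// normr_real. Qed.

Lemma rnorm_leE v (r : R) : (`|v| <= r%:C) = (rnorm v <= r).
Proof. by rewrite rnormE lecR. Qed.

Lemma rnorm_ge0 v : 0 <= rnorm v.
Proof. by rewrite -ler0c -rnormE. Qed.

Lemma rnorm0 : rnorm (0 : V) = 0.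
Proof. by rewrite /rnorm normr0. Qed.

Lemma rnorm0_eq0 v : rnorm v = 0 -> v = 0.
Proof. by move=> v0; apply/normr0_eq0; rewrite rnormE v0. Qed.

Lemma rnorm_distC v w : rnorm (v - w) = rnorm (w - v).
Proof. by rewrite /rnorm distrC. Qed.

Lemma rnormD v w : rnorm (v + w) <= rnorm v + rnorm w.
Proof. by rewrite -lecR rmorphD/= -!rnormE; exact: ler_normD. Qed.

End NormedZmod.

Lemma rnormZ (V : normedModType R[i]) (k : R[i]) (v : V) :
  rnorm (k *: v) = rnorm k * rnorm v.
Proof. by apply: complexI; rewrite rmorphM/= -!rnormE normrZ. Qed.

Implicit Types z w : R[i].

Lemma rnormM z w : rnorm (z * w) = rnorm z * rnorm w.
Proof. by apply: complexI; rewrite rmorphM/= -!rnormE normrM. Qed.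

Lemma rnormC (r : R) : rnorm (r%:C : R[i]) = `|r|.
Proof.
by rewrite /rnorm normc_def/= expr0n/= addr0 sqrtr_sqr.
Qed.

Lemma rnorm_conj z : rnorm (Num.conj z) = rnorm z.
Proof. by rewrite /rnorm norm_conjC. Qed.

Lemma mul_conj z : z * Num.conj z = ((rnorm z) ^+ 2)%:C.
Proof. by rewrite rmorphXn/= -rnormE normCK. Qed.

Lemma rnorm_sum (I : Type) (s : seq I) (F : I -> R[i]) :
  rnorm (\sum_(i <- s) F i) <= \sum_(i <- s) rnorm (F i).
Proof.
elim: s => [|i s IH]; first by rewrite !big_nil rnorm0.
by rewrite !big_cons (le_trans (rnormD _ _))// lerD2l.
Qed.

Lemma rnorm_cvgP (V : normedModType R[i]) (T : Type) (F : set_system T)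
    (f : T -> V) (l : V) : Filter F ->
  (f @ F --> l) <->
  (forall e : R, 0 < e -> \forall x \near F, rnorm (l - f x) < e).
Proof.
move=> FF; split=> [/cvgrPdist_lt fl e e0|fl].
  have /fl : (0 : R[i]) < e%:C by rewrite ltcR.
  by apply: filterS => x; rewrite rnormE ltcR.
apply/cvgrPdist_lt => e e0.
have eE : e = (complex.Re e)%:C by rewrite RRe_real// gtr0_real.
have : 0 < complex.Re e by rewrite -ltcR -eE.
by move=> /fl; apply: filterS => x; rewrite rnormE {2}eE ltcR.
Qed.

Lemma continuous_real_complex (T : topologicalType) (f : T -> R) :
  continuous f -> continuous ((fun x => (f x)%:C) : T -> R[i]^o).
Proof.
move=> cf x; apply/rnorm_cvgP => e e0.
have /cvgrPdist_lt /(_ e e0) := cf x.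
by apply: filterS => y; rewrite -rmorphB/= rnormC.
Qed.

Lemma continuous_rnorm (T : topologicalType) (f : T -> R[i]^o) :
  continuous f -> continuous (fun x => rnorm (f x : R[i])).
Proof.
move=> cf x; apply/cvgrPdist_lt => e e0.
have /rnorm_cvgP /(_ e e0) := cf x.
apply: filterS => y; apply: le_lt_trans.
have := rnormD (f x - f y : R[i]) (f y); rewrite subrK.
have := rnormD (f y - f x : R[i]) (f x); rewrite subrK rnorm_distC.
by rewrite ler_norml; lra.
Qed.

Lemma continuous_conj (T : topologicalType) (f : T -> R[i]^o) :
  continuous f -> continuous ((fun x => Num.conj (f x : R[i])) : T -> R[i]^o).
Proof.
move=> cf x; apply/rnorm_cvgP => e e0.
have /rnorm_cvgP /(_ e e0) := cf x.
by apply: filterS => y; rewrite -rmorphB/= rnorm_conj.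
Qed.

End RealNorm.

(** * Functions with compact support *)

Section CompactSupport.
Context {R : realType} {G : topGroupoidType}.
Implicit Types (f g h l : G -> R[i]).

Lemma Cc_support f : Cc R G f -> exists2 K : set G, compact K &
  forall c, ~ K c -> f c = 0.
Proof.
move=> [_ cK]; exists (closure [set a | f a != 0]) => // c nKc.
apply/eqP; apply: contrapT => /negP fc; apply: nKc.
exact: subset_closure.
Qed.

Hypothesis G_hausdorff : hausdorff_space G.

Lemma compact_support f (K : set G) :
  compact K -> (forall c, ~ K c -> f c = 0) ->
  compact (closure [set a | f a != 0]).
Proof.
move=> cK f0; apply: (subclosed_compact _ cK); first exact: closed_closure.
have /closure_id -> : closed K by exact: compact_closed.
apply: closureS => a /= /eqP fa; apply: contrapT => /f0; exact.
Qed.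

Lemma CcI f (K : set G) : continuous (f : G -> R[i]^o) -> compact K ->
  (forall c, ~ K c -> f c = 0) -> Cc R G f.
Proof. by move=> cf cK f0; split => //; exact: compact_support cK f0. Qed.

Lemma Cc_lincomb (k : R[i]) f g : Cc R G f -> Cc R G g ->
  Cc R G (fun a => k * f a + g a).
Proof.
move=> Cf Cg; have [K cK f0] := Cc_support Cf; have [L cL g0] := Cc_support Cg.
apply: (@CcI _ (K `|` L)); [|exact: compactU|]; last first.
  by move=> c /not_orP[Kc Lc]; rewrite f0// g0// mulr0 addr0.
move=> x; apply: cvgD; last by case: Cg => + _; exact.
by apply: cvgM; [exact: cvg_cst|case: Cf => + _; exact].
Qed.

Lemma Cc0 : Cc R G (fun=> 0).
Proof.
by apply: (@CcI _ set0); [move=> x; exact: cvg_cst|exact: compact0|].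
Qed.

Lemma Cc_mul f g : Cc R G f -> continuous (g : G -> R[i]^o) ->
  Cc R G (fun a => g a * f a).
Proof.
move=> Cf cg; have [K cK f0] := Cc_support Cf.
apply: (@CcI _ K) => [x||c /f0 ->]; [|exact: cK|by rewrite mulr0].
by apply: cvgM; [exact: cg|case: Cf => + _; exact].
Qed.

Lemma Cc_involution f : Cc R G f -> Cc R G (involution f).
Proof.
move=> Cf; have [K cK f0] := Cc_support Cf.
apply: (@CcI _ [set ginv a | a in K]).
- apply: continuous_conj => x; apply: continuous_comp.
    exact: ginv_continuous.
  by case: Cf => + _; exact.
- apply: continuous_compact => //; apply: continuous_subspaceT.
  exact: ginv_continuous.
- move=> c nc; rewrite /involution f0 ?rmorph0// => Kc; apply: nc.
  by exists (ginv c); rewrite ?ginvK.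
Qed.

End CompactSupport.

(** * Convolution and the regular representations *)

Section Convolution.
Context {R : realType} {G : topGroupoidType}.
Implicit Types (f g h l xi : G -> R[i]) (a b c x : G).

Lemma conv_unitl l g : (forall c, ~ unit_space G c -> l c = 0) ->
  Defs.conv l g = fun c => l (grng c) * g c.
Proof.
move=> l0; apply/funext => c; rewrite /Defs.conv.
rewrite -(@fsbig_widen _ _ _ _ [set (grng c, c)]).
- by rewrite fsbig_set1.
- move=> _ -> /=; split; last exact: gmul_rng.
  by rewrite /composable gsrc_rng.
- move=> [a b] [/= [ab abc] nab].
  have [ua|/l0->] := pselect (unit_space G a); last by rewrite mul0r.
  exfalso; apply: nab.
  have ab' : a = grng b by rewrite -ab unit_gsrc.
  have cb : c = b by rewrite -abc ab' gmul_rng.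
  by rewrite cb ab'.
Qed.

Lemma conv_unitr g h : (forall c, ~ unit_space G c -> h c = 0) ->
  Defs.conv g h = fun c => g c * h (gsrc c).
Proof.
move=> h0; apply/funext => c; rewrite /Defs.conv.
rewrite -(@fsbig_widen _ _ _ _ [set (c, gsrc c)]).
- by rewrite fsbig_set1.
- move=> _ -> /=; split; last exact: gmul_src.
  by rewrite /composable grng_src.
- move=> [a b] [/= [ab abc] nab].
  have [ub|/h0->] := pselect (unit_space G b); last by rewrite mulr0.
  exfalso; apply: nab.
  have ab' : gsrc a = b by rewrite ab unit_grng.
  have ca : c = a by rewrite -abc -ab' gmul_src.
  by rewrite ca -ab'.
Qed.

Lemma conv_unit f g x : unit_space G x ->
  Defs.conv f g x = \sum_(c \in [set c | grng c = x]) f c * g (ginv c).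
Proof.
move=> ux; rewrite /Defs.conv (@reindex_fsbig _ _ _ _ _ (fun c => (c, ginv c))
  [set c | grng c = x])//; split.
- move=> c /= <-; split; first exact: composableV.
  by [].
- by move=> c d _ _ [].
- move=> [a b] [/= ab abx]; exists a => /=.
    by rewrite -(grngM ab) abx unit_grng.
  congr pair; apply/esym/(unit_gmulE ab).
  by rewrite abx.
Qed.

(** In the sum defining [regular_rep], the only term with endpoint [c]
    contributed by [b] is that of the arrow [c b^-1], and these are exactly the
    arrows with the same range as [c]. *)
Lemma regular_repE x f xi c : gsrc c = x ->
  regular_rep x f xi c =
  \sum_(a \in [set a | grng a = grng c]) f a * xi (gmul (ginv a) c).
Proof.
move=> cx; rewrite /regular_rep.
transitivity (\sum_(b \in src_fiber x) xi b * f (gmul c (ginv b))).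
  apply: eq_fsbigr => b; rewrite inE => bx; congr (_ * _).
  have cb : composable c (ginv b) by rewrite /composable grngV cx bx.
  rewrite /regular_rep_delta -(@fsbig_widen _ _ _ _ [set gmul c (ginv b)]).
  - by rewrite fsbig_set1 gmul_divK ?eqxx ?mulr1// bx cx.
  - by move=> _ ->; rewrite /src_fiber/= gsrcM// gsrcV.
  - move=> a [ab nab] /=; case: eqP => [abc|]; last by rewrite mulr0.
    by exfalso; apply: nab; rewrite /= -abc gmulVK.
rewrite (@reindex_fsbig _ _ _ _ _ (fun a => gmul (ginv a) c)
  [set a | grng a = grng c]).
  apply: eq_fsbigr => a; rewrite inE/= => ac; rewrite mulrC.
  by rewrite gmul_ldivV.
split.
- by move=> a /= ac; rewrite /src_fiber/= gsrcM// /composable gsrcV.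
- move=> a b; rewrite !inE/= => ac bc abc.
  by rewrite -(gmul_ldivV ac) abc gmul_ldivV.
- move=> b bx; have bc : gsrc b = gsrc c by rewrite bx cx.
  exists (gmul c (ginv b)); last exact: gmul_divV.
  by rewrite /= grngM// /composable grngV bc.
Qed.

End Convolution.

(** * The reduced norm *)

Section FiberSums.
Context {G : topGroupoidType}.
Hypothesis G_etale : etale G.

Lemma range_fiber_seq (K : set G) (y : G) : compact K ->
  exists2 X : seq G, uniq X & forall a, a \in X <-> K a /\ grng a = y.
Proof.
move=> cK; have /finite_fsetP[X XE] := finite_range_fiber G_etale y cK.
exists X; first exact: fset_uniq.
by move=> a; have /(congr1 (fun A : set G => A a)) := XE => /= <-.
Qed.

Lemma range_fiber_sumE (V : nmodType) (K : set G) (y : G) (X : seq G)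
    (F : G -> V) : uniq X -> (forall a, a \in X <-> K a /\ grng a = y) ->
  (forall c, ~ K c -> F c = 0) ->
  \sum_(a \in [set a | grng a = y]) F a = \sum_(a <- X) F a.
Proof.
move=> uX XE F0; rewrite [RHS]fsbig_seq//; symmetry; apply: fsbig_widen.
  by move=> a /XE[].
move=> a [/= ay nX]; apply: F0 => Ka; apply: nX; exact/XE.
Qed.

End FiberSums.

Section ReducedNorm.
Context {R : realType} {G : topGroupoidType}.
Implicit Types (f g h l xi : G -> R[i]) (a b c x : G).

Lemma l2norm_leP x xi (M : R) : 0 <= M ->
  (l2norm x xi <= M%:E)%E <->
  forall s : seq G, uniq s -> (forall b, b \in s -> gsrc b = x) ->
    \sum_(b <- s) rnorm (xi b) ^+ 2 <= M ^+ 2.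
Proof.
move=> M0; rewrite /l2norm.
have -> : M%:E = sqrte ((M ^+ 2)%:E) by rewrite /= sqrtr_sqr ger0_norm.
rewrite lee_sqrt; last by rewrite lee_fin sqr_ge0.
split=> [le s us sx|le].
  rewrite -lee_fin; apply: le_trans le; apply: ereal_sup_ubound.
  exists [set` s]; first by split; [exact: finite_seq|move=> b /sx].
  by rewrite -fsbig_seq//= sumEFin.
apply: ge_ereal_sup => _ [X [/finite_fsetP[s ->] sx] <-].
rewrite -fsbig_seq//= ?fset_uniq// sumEFin lee_fin.
by apply: le; [exact: fset_uniq|exact: sx].
Qed.

(** The unit ball of [ell2 x], with the norm expressed by finite sums so that no
    extended reals occur in the estimates. *)
Definition ell2_ball x xi := (forall b, gsrc b <> x -> xi b = 0) /\
  forall s : seq G, uniq s -> (forall b, b \in s -> gsrc b = x) ->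
    \sum_(b <- s) rnorm (xi b) ^+ 2 <= 1.

Lemma reduced_norm_leP f (M : R) : 0 <= M ->
  (reduced_norm f <= M%:E)%E <->
  forall x xi, unit_space G x -> ell2_ball x xi ->
  forall s : seq G, uniq s -> (forall c, c \in s -> gsrc c = x) ->
    \sum_(c <- s) rnorm (regular_rep x f xi c) ^+ 2 <= M ^+ 2.
Proof.
move=> M0; split=> [le x xi ux [xi0 xi1]|le].
  have xi1' : (l2norm x xi <= 1%:E)%E.
    by apply/(l2norm_leP _ _ ler01); rewrite expr1n.
  apply/l2norm_leP => //; apply: le_trans le.
  apply: (@le_trans _ _ (regular_rep_norm x f)); apply: ereal_sup_ubound.
    by exists xi => //; do 2?split => //; exact: le_lt_trans xi1' (ltry _).
  by right; exists x.
apply: ge_ereal_sup => _ [->|[x ux <-]]; first by rewrite lee_fin.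
apply: ge_ereal_sup => _ [xi [[xi0 _] xi1] <-].
apply/l2norm_leP => //; apply: le => //; split=> //.
by have /(l2norm_leP _ _ ler01) := xi1; rewrite expr1n; apply.
Qed.

(** Such an [h] acts in each regular representation as multiplication by
    [h (grng c)]. *)
Lemma reduced_norm_unit_le1 h : (forall c, ~ unit_space G c -> h c = 0) ->
  (forall c, rnorm (h c) <= 1) -> (reduced_norm h <= 1%:E)%E.
Proof.
move=> h0 h1; apply/reduced_norm_leP => // x xi ux [xi0 xi1] s us sx.
rewrite expr1n; apply: le_trans (xi1 s us sx).
rewrite big_seq [leRHS]big_seq; apply: ler_sum => c /sx cx.
rewrite lerXn2r ?nnegrE ?rnorm_ge0//.
rewrite regular_repE// -(@fsbig_widen _ _ _ _ [set grng c]).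
- rewrite fsbig_set1 unit_ginv ?gmul_rng; last exact: unit_rng.
  by rewrite rnormM ler_piMl ?rnorm_ge0.
- by move=> _ ->; rewrite /= grng_rng.
- move=> a [/= ac nac].
  have [ua|/h0->] := pselect (unit_space G a); last by rewrite mul0r.
  by exfalso; apply: nac; rewrite /= -ac unit_grng.
Qed.

(** The value of [f] at a unit [x] is the diagonal matrix coefficient of
    [pi_x(f)] at the basis vector of [x]. *)
Lemma rnorm_unit_le_reduced_norm f x (M : R) : 0 <= M -> unit_space G x ->
  (reduced_norm f <= M%:E)%E -> rnorm (f x) <= M.
Proof.
move=> M0 ux /(reduced_norm_leP _ M0) le.
pose xi b : R[i] := (b == x)%:R.
have xiball : ell2_ball x xi.
  split=> [b bx|s us sx].
    by rewrite /xi; case: eqP => // bE; case: bx; rewrite bE unit_gsrc.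
  rewrite /xi; have [xs|xs] := boolP (x \in s).
    rewrite (bigD1_seq x)//= eqxx big1 => [|b /negPf ->].
      by rewrite addr0 (rnormC 1) normr1 expr1n.
    by rewrite rnorm0 expr0n.
  rewrite big_seq big1 ?ler01// => b bs.
  by case: eqP => [bx|_]; [rewrite -bx bs in xs|rewrite rnorm0 expr0n].
have sx c : c \in [:: x] -> gsrc c = x.
  by rewrite inE => /eqP ->; rewrite unit_gsrc.
have := le x xi ux xiball [:: x] isT sx.
rewrite big_seq1 regular_repE ?unit_gsrc//.
rewrite -(@fsbig_widen _ _ _ _ [set x]); first last.
- move=> a [/= ax nax]; rewrite /xi; case: eqP => [axx|]; last by rewrite mulr0.
  exfalso; apply: nax; rewrite /=.
  have ax' : composable (ginv a) x.
    by rewrite /composable gsrcV ax.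
  by rewrite -(gmul_ldivV ax) axx unit_ginv// unit_gmul.
- by move=> _ ->; rewrite /= unit_grng.
rewrite fsbig_set1 /xi unit_ginv// unit_gmul// eqxx mulr1.
by rewrite ler_sqr ?nnegrE ?rnorm_ge0.
Qed.

Hypothesis G_hausdorff : hausdorff_space G.
Hypothesis G_etale : etale G.

Lemma regular_repD f g x xi c : Cc R G f -> Cc R G g -> gsrc c = x ->
  regular_rep x (fun a => f a + g a) xi c =
  regular_rep x f xi c + regular_rep x g xi c.
Proof.
move=> Cf Cg cx; have [K cK f0] := Cc_support Cf.
have [L cL g0] := Cc_support Cg.
have [X uX XE] := range_fiber_seq G_etale (grng c) (compactU cK cL).
rewrite !regular_repE// !(range_fiber_sumE uX XE);
  try by move=> a /not_orP[Ka La]; rewrite ?f0// ?g0// ?addr0 mul0r.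
by rewrite -big_split/=; apply: eq_bigr => a _; rewrite mulrDl.
Qed.

(** The Cauchy-Schwarz inequality: by [regular_repE], the coordinate at [c] pairs
    [xi] with a row of the matrix of [f], whose entries are the values of [f] on
    the range fiber of [c]. *)
Lemma rnorm_regular_rep_le f x xi c (mu : R) : Cc R G f -> ell2_ball x xi ->
  gsrc c = x -> 0 < mu ->
  \sum_(a \in [set a | grng a = grng c]) rnorm (f a) ^+ 2 <= mu ^+ 2 ->
  rnorm (regular_rep x f xi c) <= mu.
Proof.
move=> Cf [_ xi1] cx mu0; have [K cK f0] := Cc_support Cf.
have [X uX XE] := range_fiber_seq G_etale (grng c) cK.
rewrite regular_repE// !(range_fiber_sumE uX XE);
  try by move=> a /f0 ->; rewrite ?mul0r ?rnorm0 ?expr0n.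
move=> fmu; apply: (le_trans (rnorm_sum _ _)).
have xiX : \sum_(a <- X) rnorm (xi (gmul (ginv a) c)) ^+ 2 <= 1.
  rewrite -(big_map (fun a => gmul (ginv a) c) xpredT
    (fun b => rnorm (xi b) ^+ 2)).
  apply: xi1.
    rewrite map_inj_in_uniq// => a b /XE[_ ac] /XE[_ bc] ab.
    by rewrite -(gmul_ldivV ac) ab gmul_ldivV.
  move=> _ /mapP[a /XE[_ ac] ->]; rewrite gsrcM// /composable gsrcV.
  by rewrite ac.
(* Each term is bounded by the weighted AM-GM inequality
   [2 mu u v <= u ^+ 2 + mu ^+ 2 v ^+ 2]. *)
rewrite -(ler_pM2l (_ : 0 < 2 * mu)); last by rewrite mulr_gt0.
apply: (@le_trans _ _ (\sum_(a <- X) (rnorm (f a) ^+ 2 +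
    mu ^+ 2 * rnorm (xi (gmul (ginv a) c)) ^+ 2))).
  rewrite mulr_sumr; apply: ler_sum => a _; rewrite rnormM.
  have := sqr_ge0 (rnorm (f a) - mu * rnorm (xi (gmul (ginv a) c))).
  by nra.
rewrite big_split/= -mulr_sumr.
have : mu ^+ 2 * \sum_(a <- X) rnorm (xi (gmul (ginv a) c)) ^+ 2 <= mu ^+ 2.
  by rewrite ler_piMr// sqr_ge0.
by nra.
Qed.

(** Each coordinate of a vector [pi_x(f) xi] is that of [pi_x(f - g) xi] up to
    [mu], by [rnorm_regular_rep_le].  A finite square sum thus gains an error
    that vanishes with [mu], and the norm of [pi_x(f - g)] bounds the rest. *)
Lemma reduced_norm_le_approx f (M : R) : 0 < M -> Cc R G f ->
  (forall mu : R, 0 < mu -> exists g, [/\ Cc R G g,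
     (reduced_norm (fun a => f a - g a)%R <= M%:E)%E &
     forall x, unit_space G x ->
       \sum_(a \in [set a | grng a = x]) rnorm (g a) ^+ 2 <= mu ^+ 2]) ->
  (reduced_norm f <= (2 * M)%:E)%E.
Proof.
move=> M0 Cf approx; apply/reduced_norm_leP; first by rewrite mulr_ge0// ltW.
move=> x xi ux xiball s us sx.
(* With this error per coordinate the total square error over [s] is at most
   [M ^+ 2]. *)
have [] := approx (M / (size s).+1%:R); first by rewrite divr_gt0.
move=> g [Cg /(reduced_norm_leP _ (ltW M0)) fgM gmu].
have Cfg : Cc R G (fun a => f a - g a).
  rewrite (_ : (fun a => _) = fun a => -1 * g a + f a); first exact: Cc_lincomb.
  by apply/funext => a; rewrite mulN1r addrC.
have {}fgM := fgM x xi ux xiball s us sx.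
apply: (@le_trans _ _ (\sum_(c <- s)
    (2 * rnorm (regular_rep x (fun a => f a - g a) xi c) ^+ 2 +
     2 * (M / (size s).+1%:R) ^+ 2))).
  rewrite big_seq [leRHS]big_seq; apply: ler_sum => c /sx cx.
  have -> : f = fun a => (f a - g a) + g a.
    by apply/funext => a; rewrite subrK.
  rewrite regular_repD//.
  rewrite (_ : (fun a => f a - g a + g a - g a) = fun a => f a - g a).
    2: by apply/funext => a; rewrite subrK.
  have gc : rnorm (regular_rep x g xi c) <= M / (size s).+1%:R.
    apply: rnorm_regular_rep_le => //; first by rewrite divr_gt0.
    by apply: gmu; exact: unit_rng.
  have := rnormD (regular_rep x (fun a => f a - g a) xi c)
                 (regular_rep x g xi c).
  have := rnorm_ge0 (regular_rep x (fun a => f a - g a) xi c +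
                     regular_rep x g xi c).
  have := rnorm_ge0 (regular_rep x g xi c).
  have := sqr_ge0 (rnorm (regular_rep x (fun a => f a - g a) xi c) -
                   rnorm (regular_rep x g xi c)).
  move: gc; move: (rnorm _) (rnorm _) (rnorm _) (M / _) => u v w m.
  by nra.
rewrite big_split/= -mulr_sumr big_const_seq count_predT iter_addr_0.
have sM : (M / (size s).+1%:R) ^+ 2 *+ size s <= M ^+ 2.
  rewrite expr_div_n -mulr_natr -mulrA ler_piMr ?sqr_ge0//.
  rewrite mulrC ler_pdivrMr ?exprn_gt0// mul1r -natrX ler_nat.
  by rewrite (leq_trans (leqnSn _))// leq_pmulr.
rewrite -mulrnAr; move: fgM sM.
by move: (\sum_(_ <- _) _) (_ *+ size s) => S T; nra.
Qed.

End ReducedNorm.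

(** * Cutting down a function to a multiple of a bump *)

(** If [p] is a bump function at [x] then [q = p F] exceeds [lam] at [x]; with
    [h = lam p / max q lam] the product [h F] is [min q lam], which is
    constantly [lam] on the support of [l = max q lam - lam]. *)
Lemma cutoff_pair (R : realType) (T : topologicalType) (F : T -> R) (lam : R)
    (V : set T) (x : T) :
  locally_compact [set: T] -> hausdorff_space T -> continuous F -> 0 < lam ->
  open V -> V x -> lam < F x ->
  exists l h : T -> R, exists K : set T,
    [/\ compact K, K `<=` V, continuous l & continuous h] /\
    [/\ forall y, ~ K y -> l y = 0 /\ h y = 0, forall y, 0 <= h y <= 1,
        forall y, l y * h y * F y = lam * l y & 0 < l x].
Proof.
move=> lcT hT cF lam0 oV Vx Fx.
have [p [cp p01 px [K cK [KV p0]]]] := locally_compact_bump R lcT hT oV Vx.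
pose m y := Num.max (p y * F y) lam.
have m0 y : 0 < m y by rewrite lt_max lam0 orbT.
have cm : continuous m.
  move=> y; apply: (@continuous_max R T (fun y => p y * F y) (fun=> lam)).
    by apply: cvgM; [exact: cp|exact: cF].
  exact: cvg_cst.
exists (fun y => m y - lam), (fun y => lam * p y / m y), K; split; split => //.
- by move=> y; apply: cvgB; [exact: cm|exact: cvg_cst].
- move=> y; apply: cvgM; last by apply: cvgV; [rewrite gt_eqF|exact: cm].
  by apply: cvgM; [exact: cvg_cst|exact: cp].
- by move=> y /p0 py; rewrite /m py mul0r mulr0 mul0r max_r ?subrr// ltW.
- move=> y; have /andP[py0 py1] := p01 y.
  apply/andP; split.
    by rewrite divr_ge0 ?mulr_ge0 ?(ltW lam0) ?(ltW (m0 y)).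
  rewrite ler_pdivrMr// mul1r; apply: (@le_trans _ _ lam).
    by rewrite ler_piMr// ltW.
  by rewrite le_max lexx orbT.
- move=> y; have [qlam|qlam] := leP (p y * F y) lam.
    by rewrite /m max_r// subrr !mul0r mulr0.
  have mE : m y = p y * F y by rewrite /m max_l// ltW.
  have hF : lam * p y / m y * F y = lam.
    by rewrite mulrAC -(mulrA lam) -mE mulfK// gt_eqF.
  by rewrite -mulrA hF mulrC.
- by rewrite /m px mul1r max_l ?subr_gt0// ltW.
Qed.

(** * Inverses and ideals in C-star algebras *)

Section CStarTheory.
Context {R : realType} {B : cstarAlgType R}.
Implicit Types a b c z w : B.

Lemma rnorm_cmul a b : rnorm (cmul a b) <= rnorm a * rnorm b.
Proof. by rewrite -rnorm_leE rmorphM/= -!rnormE; exact: cnormM. Qed.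

Lemma cmul0 a : cmul a 0 = 0.
Proof. by apply: (@addrI _ (cmul a 0)); rewrite -cmulDr !addr0. Qed.

Lemma cmul0l a : cmul 0 a = 0.
Proof. by apply: (@addrI _ (cmul 0 a)); rewrite -cmulDl !addr0. Qed.

Lemma cmulBr a b c : cmul a (b - c) = cmul a b - cmul a c.
Proof. by apply/(@addIr _ (cmul a c)); rewrite -cmulDr !subrK. Qed.

Lemma cmulBl a b c : cmul (a - b) c = cmul a c - cmul b c.
Proof. by apply/(@addIr _ (cmul b c)); rewrite -cmulDl !subrK. Qed.

Lemma rnorm_cstar_le b : rnorm b <= rnorm (cstar b).
Proof.
have [b0|] := eqVneq (rnorm b) 0; first by rewrite b0 rnorm_ge0.
move=> bn0; have b0 : 0 < rnorm b by rewrite lt_def bn0 rnorm_ge0.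
rewrite -(ler_pM2r b0); apply: le_trans (rnorm_cmul _ _).
by rewrite /rnorm cnorm_star rnormE -rmorphXn.
Qed.

Lemma rnorm_cstar b : rnorm (cstar b) = rnorm b.
Proof.
by apply/eqP; rewrite eq_le rnorm_cstar_le -{2}(cstarK b) rnorm_cstar_le.
Qed.

(** The Neumann series: [1 + w] is the inverse of [1 - z].  The solution is the
    limit of the iterates of the contraction [w |-> z + z w]. *)
Lemma neumann z : rnorm z < 1 -> exists w, w = z + cmul z w.
Proof.
move=> z1; pose t := rnorm z; pose f w := z + cmul z w.
have t0 : 0 <= t := rnorm_ge0 _.
have t1 : 0 < 1 - t by rewrite subr_gt0.
have fC u v : rnorm (f u - f v) <= t * rnorm (u - v).
  rewrite /f opprD addrACA subrr add0r -cmulBr; exact: rnorm_cmul.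
have fnC n u v : rnorm (iter n f u - iter n f v) <= t ^+ n * rnorm (u - v).
  elim: n => [|n IH]; first by rewrite expr0 mul1r.
  by rewrite (le_trans (fC _ _))// exprS -mulrA ler_wpM2l.
pose u n := iter n f 0.
have ub n : rnorm (u n) <= (1 - t)^-1.
  elim: n => [|n IH]; first by rewrite /u/= rnorm0 invr_ge0 ltW.
  apply: (le_trans (rnormD _ _)).
  apply: (@le_trans _ _ (t + t * (1 - t)^-1)).
    by rewrite lerD2l (le_trans (rnorm_cmul _ _))// ler_wpM2l.
  have -> : t + t / (1 - t) = (1 - t)^-1 * (t * (1 - t) + t).
    by field; rewrite gt_eqF.
  rewrite -[leRHS]mulr1 ler_wpM2l ?invr_ge0 ?(ltW t1)//.
  by have := sqr_ge0 (t - 1); nra.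
have small (e : R) : 0 < e -> \forall n \near \oo, t ^+ n * (1 - t)^-1 < e.
  move=> e0; have te : 0 < e * (1 - t) by rewrite mulr_gt0.
  have /cvgrPdist_lt /(_ _ te) : (t ^+ n) @[n --> \oo] --> (0 : R).
    by apply: cvg_expr; rewrite ger0_norm.
  apply: filterS => n; rewrite sub0r normrN ger0_norm ?exprn_ge0// => tn.
  by rewrite ltr_pdivrMr.
have uC n k : rnorm (u n - u (n + k)%N) <= t ^+ n * (1 - t)^-1.
  rewrite rnorm_distC /u iterD (le_trans (fnC _ _ _))// subr0.
  by rewrite ler_wpM2l ?exprn_ge0//; exact: ub.
have cu : cvgn u.
  apply: cauchy_cvg; apply: cauchy_exP => e e0.
  have eE : e = (complex.Re e)%:C by rewrite RRe_real// gtr0_real.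
  have e0' : 0 < complex.Re e by rewrite -ltcR -eE.
  have [N _ sN] := small _ e0'.
  exists (u N); exists N => // n /= Nn; rewrite -ball_normE/= rnormE eE ltcR.
  by rewrite -(subnKC Nn) (le_lt_trans (uC _ _))//; apply: sN => /=.
exists (limn u); apply/eqP; rewrite -subr_eq0; apply/eqP/rnorm0_eq0.
apply/eqP; rewrite eq_le rnorm_ge0 andbT; apply/ler_addgt0Pr => e e0.
rewrite add0r.
have /rnorm_cvgP := cu; move/(_ (e / 2)).
rewrite divr_gt0// => /(_ isT) [N _ uN].
have uN0 := uN N (leqnn N); have uN1 := uN N.+1 (leqnSn N).
have -> : limn u - (z + cmul z (limn u)) =
    (limn u - u N.+1) + (f (u N) - f (limn u)).
  by rewrite /f /u/= addrA subrK.
apply: (le_trans (rnormD _ _)).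
have := fC (u N) (limn u); rewrite (rnorm_distC (u N)).
have : t * rnorm (limn u - u N) <= rnorm (limn u - u N).
  by rewrite ler_piMl ?rnorm_ge0// ltW.
move: uN0 uN1 => /=.
by move: (rnorm _) (rnorm _) (rnorm _) => ? ? ?; lra.
Qed.

(** Modulo an ideal containing [j], the hypothesis is [l (1 - z) = 0], where
    [1 - z] is invertible.  The conclusion writes [l] as an explicit element of
    the ideal, so that any ring homomorphism killing [j] kills [l]. *)
Lemma ideal_absorb (l z j : B) : rnorm z < 1 -> l = cmul l z + cmul l j ->
  exists w, l = cmul l j + cmul (cmul l j) w.
Proof.
move=> /neumann[w wE] lE; exists w.
have -> : cmul l j = l - cmul l z by rewrite {2}lE addrAC subrr add0r.
have lw : cmul l w = cmul l z + cmul l (cmul z w) by rewrite -cmulDr -wE.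
by rewrite cmulBl -cmulA lw addrK subrK.
Qed.

End CStarTheory.

(** * Ideals meeting the functions on the units trivially *)

Section ReducedAlgebra.
Context {R : realType} {G : topGroupoidType} {B : cstarAlgType R}.
Context {iota : (G -> R[i]) -> B}.
Hypothesis B_reduced : is_reduced_cstar iota.
Hypothesis G_hausdorff : hausdorff_space G.
Implicit Types f g : G -> R[i].

Lemma iota0 : iota (fun=> 0) = 0.
Proof.
have := iota_linear B_reduced (-1) (Cc0 (R := R) G_hausdorff) (Cc0 G_hausdorff).
rewrite (_ : (fun a : G => -1 * 0 + 0) = fun=> 0); last first.
  by apply/funext => a; rewrite mulr0 addr0.
by rewrite scaleN1r addNr.
Qed.

Lemma iotaZ (k : R[i]) f : Cc R G f -> iota (fun a => k * f a) = k *: iota f.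
Proof.
move=> Cf; have := iota_linear B_reduced k Cf (Cc0 G_hausdorff).
rewrite iota0 addr0 => <-; congr iota.
by apply/funext => a; rewrite addr0.
Qed.

Lemma iotaB f g : Cc R G f -> Cc R G g ->
  iota (fun a => f a - g a) = iota f - iota g.
Proof.
move=> Cf Cg; have := iota_linear B_reduced (-1) Cg Cf.
rewrite scaleN1r addrC => <-; congr iota.
by apply/funext => a; rewrite mulN1r addrC.
Qed.

Lemma rnorm_iota f : Cc R G f -> (rnorm (iota f))%:E = reduced_norm f.
Proof. exact: iota_norm. Qed.

Lemma iota_approx (a : B) (e : R) : 0 < e ->
  exists2 g, Cc R G g & rnorm (a - iota g) < e.
Proof.
move=> e0; have [] := iota_dense B_reduced (O := ball a e%:C).
- by exists a; apply: ballxx; rewrite ltcR.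
- by apply: ball_open; rewrite ltcR.
move=> b [+ [g Cg gb]]; rewrite -{}gb -ball_normE/= rnormE ltcR => ag.
by exists g.
Qed.

Lemma C0_subalgebra_iota f (K : set G) : closed (unit_space G) ->
  continuous (f : G -> R[i]^o) -> compact K -> K `<=` unit_space G ->
  (forall c, ~ K c -> f c = 0) -> C0_subalgebra iota (iota f).
Proof.
move=> cG cf cK KG f0.
have fu c : ~ unit_space G c -> f c = 0 by move=> nu; apply: f0 => /KG.
have cfu : {within unit_space G, continuous (f : G -> R[i]^o)}.
  exact: continuous_subspaceT.
exists f.
  split=> // e e0; have eE : e = (complex.Re e)%:C.
    by rewrite RRe_real// gtr0_real.
  have -> : [set x | unit_space G x /\ e <= `|f x|] =
      K `&` [set x | complex.Re e <= rnorm (f x)].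
    apply/seteqP; split=> x /= [Kx ex]; split=> //.
    - by apply: contrapT => /f0 fx; move: ex; rewrite fx normr0 lt_geF.
    - by move: ex; rewrite rnormE eE lecR.
    - exact: KG.
    - by rewrite rnormE eE lecR.
  apply: compact_closedI => //.
  have : closed [set y : R | complex.Re e <= y] by exact: closed_ge.
  by move/closed_comp; apply => x _; exact: continuous_rnorm.
move=> e e0; exists f; split=> //.
- split=> //; rewrite setIC; apply: compact_closedI => //.
  exact: compact_support cK f0.
- by move=> x _; rewrite subrr normr0 ltW.
- by rewrite subrr normr0 ltW.
Qed.

Hypothesis G_locally_compact : locally_compact [set: G].
Hypothesis G_etale : etale G.
Hypothesis G_effective : effective G.

(** The square sums of [g] over the range fibers are the values on the units of
    the product [f] of [g] and its adjoint.  If they exceeded [lam] somewhere,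
    they would do so on an open set of units, and [effective_shrink] would give a
    smaller one on which [f] has no values outside the units; for the functions
    [l] and [h] of [cutoff_pair], supported there, [l f h = lam l] exactly.
    Since [lam] is more than the distance from [f] to the element
    [cmul a (cstar a)] of the kernel, [ideal_absorb] puts [l] in the kernel,
    against injectivity on the functions on the units. *)
Lemma fiber_sum_le_kernel_dist (A : cstarAlgType R) (phi : B -> A)
    (a : B) g (lam : R) :
  star_homomorphism phi -> set_inj (C0_subalgebra iota) phi -> phi a = 0 ->
  Cc R G g -> 0 < lam ->
  rnorm (cmul (iota g) (cstar (iota g)) - cmul a (cstar a)) < lam ->
  forall x, unit_space G x ->
    \sum_(c \in [set c | grng c = x]) rnorm (g c) ^+ 2 <= lam.
Proof.
move=> phi_hom phi_inj phia0 Cg lam0 dist x0 ux0.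
rewrite leNgt; apply/negP => Fx0.
have cG := closed_unit_space G_hausdorff.
have [K cK g0] := Cc_support Cg.
pose F y := \sum_(c \in [set c | grng c = y]) rnorm (g c) ^+ 2.
have cF : continuous F.
  apply: (continuous_fiber_sum G_etale G_hausdorff cK) => [y|c /g0 ->].
    by apply: cvgM; apply: continuous_rnorm; case: Cg.
  by rewrite rnorm0 expr0n.
pose U := unit_space G `&` F @^-1` [set r | lam < r].
have oU : open U.
  apply: openI; first exact: open_unit_space.
  by apply: open_comp => [y _|]; [exact: cF|exact: open_gt].
have KV : compact [set ginv c | c in K].
  apply: continuous_compact => //; apply: continuous_subspaceT.
  exact: ginv_continuous.
have [V [oV [x Vx] VU offdiag]] := effective_shrink
  G_hausdorff G_etale G_effective
  (compact_composable_products G_hausdorff cK KV) oU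
  (ex_intro _ x0 (conj ux0 Fx0)) (fun y Uy => proj1 Uy).
have [l [h [L [[cL LV cl ch] [lh0 h01 lhF lx]]]]] := cutoff_pair
  G_locally_compact G_hausdorff cF lam0 oV Vx (proj2 (VU _ Vx)).
have Lu c : L c -> unit_space G c by move=> /LV /VU[].
pose lC c : R[i] := (l c)%:C; pose hC c : R[i] := (h c)%:C.
have lC0 c : ~ L c -> lC c = 0 by move=> /lh0[lc _]; rewrite /lC lc.
have hC0 c : ~ L c -> hC c = 0 by move=> /lh0[_ hc]; rewrite /hC hc.
have lCu c : ~ unit_space G c -> lC c = 0 by move=> nu; apply: lC0 => /Lu.
have hCu c : ~ unit_space G c -> hC c = 0 by move=> nu; apply: hC0 => /Lu.
have clC : continuous (lC : G -> R[i]^o) by exact: continuous_real_complex.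
have chC : continuous (hC : G -> R[i]^o) by exact: continuous_real_complex.
have Cl : Cc R G lC by apply: CcI cL lC0.
have Ch : Cc R G hC by apply: CcI cL hC0.
have Cg' : Cc R G (involution g) by exact: Cc_involution.
pose lg c := lC (grng c) * g c; pose gh c := involution g c * hC (gsrc c).
have Clg : Cc R G lg.
  apply: (Cc_mul G_hausdorff Cg) => c.
  by apply: continuous_comp; [exact: grng_continuous|exact: clC].
have Cgh : Cc R G gh.
  rewrite (_ : gh = fun c => hC (gsrc c) * involution g c); last first.
    by apply/funext => c; rewrite mulrC.
  apply: (Cc_mul G_hausdorff Cg') => c.
  by apply: continuous_comp; [exact: gsrc_continuous|exact: chC].
(* The factors [l g] and [g^* h] are in [Cc], and their product is [l f h]. *)
have lgh : Defs.conv lg gh = fun c => lam%:C * lC c.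
  apply/funext => c; have [uc|nuc] := pselect (unit_space G c).
    rewrite conv_unit//.
    have [X uX XE] := range_fiber_seq G_etale c cK.
    rewrite (range_fiber_sumE uX XE) => [|b /g0 gb]; last first.
      by rewrite /lg gb mulr0 mul0r.
    transitivity (\sum_(b <- X) (l c * h c * rnorm (g b) ^+ 2)%:C).
      rewrite big_seq [RHS]big_seq; apply: eq_bigr => b /XE[_ bc].
      rewrite /lg /gh /involution ginvK gsrcV bc.
      transitivity (lC c * hC c * (g b * Num.conj (g b))); first by ring.
      by rewrite mul_conj -!rmorphM.
    rewrite -rmorph_sum/= -mulr_sumr -rmorphM/= -lhF; congr (_ * _)%:C.
    rewrite /F (range_fiber_sumE uX XE)// => b /g0 ->.
    by rewrite rnorm0 expr0n.
  rewrite lCu// mulr0 /Defs.conv; apply: fsbig1 => -[b d] [/= bd bdc].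
  apply: contrapT => /eqP; rewrite /lg /gh !mulf_eq0 !negb_or.
  move=> /andP[/andP[lb gb] /andP[gd hd]]; apply: nuc; apply: offdiag.
  - exists (b, d) => //; split => //; split => /=.
      by apply: contrapT => /g0 /eqP; rewrite (negPf gb).
    exists (ginv d); last by rewrite ginvK.
    apply: contrapT => /g0 gd0; move: gd.
    by rewrite /involution gd0 rmorph0 eqxx.
  - rewrite -bdc grngM//; apply: LV; apply: contrapT => /lC0 /eqP.
    by rewrite (negPf lb).
  - rewrite -bdc gsrcM//; apply: LV; apply: contrapT => /hC0 /eqP.
    by rewrite (negPf hd).
have iota_lg : iota lg = cmul (iota lC) (iota g).
  by rewrite -(iota_conv B_reduced Cl Cg) (conv_unitl _ lCu).
have iota_gh : iota gh = cmul (cstar (iota g)) (iota hC).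
  rewrite -(iota_involution B_reduced Cg).
  by rewrite -(iota_conv B_reduced Cg' Ch) (conv_unitr _ hCu).
have prodE : cmul (cmul (iota lC) (iota g)) (cmul (cstar (iota g)) (iota hC)) =
    lam%:C *: iota lC.
  by rewrite -iota_lg -iota_gh -(iota_conv B_reduced Clg Cgh) lgh (iotaZ _ Cl).
pose D := cmul (iota g) (cstar (iota g)); pose H := iota hC.
pose k : R[i] := (lam^-1)%:C.
have kl : k * lam%:C = 1 by rewrite -rmorphM/= mulVf// gt_eqF.
have z1 : rnorm (k *: cmul (D - cmul a (cstar a)) H) < 1.
  have H1 : rnorm H <= 1.
    rewrite -lee_fin rnorm_iota//; apply: reduced_norm_unit_le1 => // c.
    by rewrite /hC rnormC ger0_norm; have /andP[] := h01 c.
  rewrite rnormZ rnormC gtr0_norm ?invr_gt0// ltr_pdivrMl// mulr1.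
  apply: le_lt_trans dist; apply: (le_trans (rnorm_cmul _ _)).
  by rewrite ler_piMr ?rnorm_ge0.
have lzj : iota lC = cmul (iota lC) (k *: cmul (D - cmul a (cstar a)) H) +
    cmul (iota lC) (k *: cmul (cmul a (cstar a)) H).
  rewrite -cmulDr -scalerDr -cmulDl subrK -cscalerAr.
  rewrite -[LHS]scale1r -kl -scalerA -prodE; congr (_ *: _).
  by rewrite /D /H !cmulA.
have [w lE] := ideal_absorb z1 lzj.
have phi0 : phi 0 = 0.
  have := star_hom_linear phi_hom (-1) 0 0.
  by rewrite scaler0 addr0 scaleN1r addNr.
have philC : phi (iota lC) = 0.
  have phij : phi (k *: cmul (cmul a (cstar a)) H) = 0.
    by rewrite cscalerAr -cmulA (star_homM phi_hom) phia0 cmul0l.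
  have phiD u v : phi (u + v) = phi u + phi v.
    by have := star_hom_linear phi_hom 1 u v; rewrite !scale1r.
  by rewrite lE phiD !(star_homM phi_hom) phij cmul0 cmul0l addr0.
have lC_eq0 : iota lC = 0.
  apply: phi_inj; rewrite ?inE ?philC//.
    exact: (C0_subalgebra_iota cG clC cL).
  have c0 : continuous ((fun=> 0) : G -> R[i]^o) by move=> y; exact: cvg_cst.
  rewrite -iota0.
  exact: (C0_subalgebra_iota cG c0 (@compact0 G) (@sub0set _ _)
    (fun _ _ => erefl)).
have : rnorm (lC x) <= 0.
  apply: rnorm_unit_le_reduced_norm => //; first by case: (VU _ Vx).
  by rewrite -rnorm_iota// lC_eq0 rnorm0.
by rewrite /lC rnormC normr_le0 gt_eqF.
Qed.

(** If [iota g'] is another approximation of [a], then it is close to [iota g],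
    while by [fiber_sum_le_kernel_dist] the square sums of [g'] over the range
    fibers tend to zero as [iota g'] tends to [a]; so [reduced_norm_le_approx]
    applies. *)
Lemma rnorm_iota_near_kernel (A : cstarAlgType R) (phi : B -> A)
    (a : B) g (eta : R) :
  star_homomorphism phi -> set_inj (C0_subalgebra iota) phi -> phi a = 0 ->
  Cc R G g -> 0 < eta -> rnorm (a - iota g) < eta ->
  rnorm (iota g) <= 4 * eta.
Proof.
move=> phi_hom phi_inj phia0 Cg eta0 ag.
rewrite -lee_fin rnorm_iota// (_ : 4 * eta = 2 * (2 * eta)); last by ring.
apply: reduced_norm_le_approx => //; first by rewrite mulr_gt0.
move=> mu mu0; have mu20 : 0 < mu ^+ 2 by rewrite exprn_gt0.
(* For [iota g'] within [delta <= eta] of [a], the elements [iota g' (iota g')^*]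
   and [a a^* ] differ by at most [delta * (2 * rnorm a + eta)]. *)
pose N := 2 * rnorm a + eta + 1.
have N0 : 0 < N by rewrite /N; have := rnorm_ge0 a; lra.
pose delta := Num.min eta (mu ^+ 2 / N).
have delta0 : 0 < delta by rewrite lt_min eta0 divr_gt0.
have [g' Cg' ag'] := iota_approx a delta0.
exists g'; split=> //.
  rewrite -rnorm_iota; last first.
    rewrite (_ : (fun _ => _) = fun c => -1 * g' c + g c).
      exact: Cc_lincomb.
    by apply/funext => c; rewrite mulN1r addrC.
  rewrite lee_fin iotaB// -(subrK a (iota g)) -addrA.
  apply: (le_trans (rnormD _ _)); rewrite rnorm_distC.
  have : delta <= eta by rewrite ge_min lexx.
  by move: ag ag'; move: (rnorm _) (rnorm _) => u v; lra.
apply: (fiber_sum_le_kernel_dist phi_hom phi_inj phia0 Cg' mu20).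
set b := iota g' in ag' *.
have -> : cmul b (cstar b) - cmul a (cstar a) =
    cmul (b - a) (cstar b) + cmul a (cstar (b - a)).
  have csb : cstar (b - a) = cstar b - cstar a.
    by apply: (@addIr _ (cstar a)); rewrite -cstarD !subrK.
  by rewrite csb cmulBl cmulBr addrA subrK.
have uN : delta * N <= mu ^+ 2 by rewrite -ler_pdivlMr// ge_min lexx orbT.
apply: (le_lt_trans (rnormD _ _)).
have := rnorm_cmul (b - a) (cstar b); have := rnorm_cmul a (cstar (b - a)).
rewrite !rnorm_cstar; set u := rnorm (b - a); set p := rnorm (cmul _ _).
set q := rnorm (cmul _ _) => pu qu.
have ud : u < delta by rewrite /u rnorm_distC.
have ueta : u <= eta by rewrite (le_trans (ltW ud))// ge_min lexx.
have u0 : 0 <= u := rnorm_ge0 _.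
have a0 := rnorm_ge0 a.
have bu : rnorm b <= eta + rnorm a.
  by have := rnormD (b - a) a; rewrite subrK -/u; lra.
have ub : u * rnorm b <= u * (eta + rnorm a) by rewrite ler_wpM2l.
have udN : u * (2 * rnorm a + eta) <= delta * (2 * rnorm a + eta).
  by rewrite ler_wpM2r ?(ltW ud)// addr_ge0 ?mulr_ge0 ?(ltW eta0).
by move: uN; rewrite /N; nra.
Qed.

End ReducedAlgebra.

(** * Injectivity *)

Theorem theorem4p2p7 (R : realType) (G : topGroupoidType)
    (G_second_countable : @second_countable G)
    (G_locally_compact : locally_compact [set: G])
    (G_hausdorff : hausdorff_space G)
    (G_etale : etale G)
    (G_effective : effective G)
    (CrG : cstarAlgType R) (iota : (G -> R[i]) -> CrG)
    (CrG_reduced : is_reduced_cstar iota)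
    (A : cstarAlgType R) (phi : CrG -> A)
    (phi_hom : star_homomorphism phi)
    (phi_inj_C0 : set_inj (C0_subalgebra iota) phi) :
  injective phi.
Proof.
move=> a1 a2 phi12.
have phia0 : phi (a1 - a2) = 0.
  have := star_hom_linear phi_hom (-1) a2 a1.
  by rewrite !scaleN1r phi12 addNr addrC.
apply/eqP; rewrite -subr_eq0; apply/eqP; set a := a1 - a2 in phia0 *.
apply: rnorm0_eq0; apply/eqP; rewrite eq_le rnorm_ge0 andbT.
apply/ler_addgt0Pr => e e0; rewrite add0r.
have eta0 : 0 < e / 5 by rewrite divr_gt0.
have [g Cg ag] := iota_approx CrG_reduced a eta0.
have := rnorm_iota_near_kernel CrG_reduced G_hausdorff G_locally_compact G_etale
  G_effective phi_hom phi_inj_C0 phia0 Cg eta0 ag.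
have := rnormD (a - iota g) (iota g); rewrite subrK.
by move: ag; move: (rnorm _) (rnorm _) (rnorm _) => u v w; lra.
Qed.
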